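(* Let $\mathbf{R}$ be the variety of all ai-semirings satisfying the identity $xy\approx xz$. Then $\mathbf{R}$ is a Cross variety. Therefore, every subvariety of $\mathbf{R}$ is both finitely based and finitely generated.
   Context: An additively idempotent semiring (ai-semiring) is an algebra $(S,+,\cdot)$ with two binary operations such that $(S,+)$ is a commutative idempotent semigroup, $(S,\cdot)$ is a semigroup, and both distributive laws $x(y+z)\approx xy+xz$ and $(x+y)z\approx xz+yz$ hold. No neutral or zero elements are part of the signature. A variety of ai-semirings is a class of ai-semirings closed under subalgebras, homomorphic images and arbitrary direct products (equivalently, defined by identities). A variety is finitely based if it can be defined by finitely many identities; it is finitely generated if it can be generated by a finite number of finite algebras. A variety is a Cross variety if it is finitely based, finitely generated, and has only finitely many subvarieties. *)

(* Defs.v *)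
From mathcomp Require Import all_boot.
From mathcomp Require Import boolp classical_sets functions cardinality.

Set Implicit Arguments.
Unset Strict Implicit.
Unset Printing Implicit Defensive.

Local Open Scope classical_set_scope.

Declare Scope ais_scope.
Delimit Scope ais_scope with ais.

(* As usual in universal algebra, carriers are nonempty; no zero or unit is
   part of the structure. *)
Record aiSemiring := AISemiring {
  carrier :> Type;
  ais_add : carrier -> carrier -> carrier;
  ais_mul : carrier -> carrier -> carrier;
  ais_inhabited : inhabited carrier;
  ais_addA : associative ais_add;
  ais_addC : commutative ais_add;
  ais_addI : idempotent_op ais_add;
  ais_mulA : associative ais_mul;
  ais_mulDr : right_distributive ais_mul ais_add;
  ais_mulDl : left_distributive ais_mul ais_add
}.

Arguments ais_add {a} _ _.
Arguments ais_mul {a} _ _.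
Notation "x + y" := (ais_add x y) : ais_scope.
Notation "x * y" := (ais_mul x y) : ais_scope.
Local Open Scope ais_scope.

Definition is_hom (A B : aiSemiring) (f : A -> B) : Prop :=
  {morph f : x y / x + y} /\ {morph f : x y / x * y}.

Section Product.
Variables (I : Type) (A : I -> aiSemiring).
Implicit Types x y : forall i, A i.

Definition prod_add x y : forall i, A i := fun i => x i + y i.
Definition prod_mul x y : forall i, A i := fun i => x i * y i.

Lemma prod_inhabited : inhabited (forall i, A i).
Proof.
suff pt i : A i by exists.
have [a _] : {a : A i | True}; last exact: a.
by apply: cid; case: (ais_inhabited (A i)) => a; exists a.
Qed.

Lemma prod_addA : associative prod_add.
Proof. by move=> x y z; apply: functional_extensionality_dep => i; exact: ais_addA. Qed.

Lemma prod_addC : commutative prod_add.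
Proof. by move=> x y; apply: functional_extensionality_dep => i; exact: ais_addC. Qed.

Lemma prod_addI : idempotent_op prod_add.
Proof. by move=> x; apply: functional_extensionality_dep => i; exact: ais_addI. Qed.

Lemma prod_mulA : associative prod_mul.
Proof. by move=> x y z; apply: functional_extensionality_dep => i; exact: ais_mulA. Qed.

Lemma prod_mulDr : right_distributive prod_mul prod_add.
Proof. by move=> x y z; apply: functional_extensionality_dep => i; exact: ais_mulDr. Qed.

Lemma prod_mulDl : left_distributive prod_mul prod_add.
Proof. by move=> x y z; apply: functional_extensionality_dep => i; exact: ais_mulDl. Qed.

Definition prod_ais : aiSemiring :=
  AISemiring prod_inhabited prod_addA prod_addC prod_addI
    prod_mulA prod_mulDr prod_mulDl.

End Product.

Inductive term := Var of nat | Add of term & term | Mul of term & term.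

Fixpoint eval (A : aiSemiring) (v : nat -> A) (t : term) : A :=
  match t with
  | Var n => v n
  | Add s t => eval v s + eval v t
  | Mul s t => eval v s * eval v t
  end.

Definition identity := (term * term)%type.

Definition satisfies (A : aiSemiring) (e : identity) : Prop :=
  forall v : nat -> A, eval v e.1 = eval v e.2.

Definition models (E : set identity) : set aiSemiring :=
  [set A | forall e, E e -> satisfies A e].

(* Subalgebras are taken up to isomorphism, as domains of injective
   homomorphisms; closure under isomorphism is in any case a consequence of
   closure under homomorphic images.  The index type of a product may be
   empty, so a variety always contains the one-element algebras. *)
Definition is_variety (K : set aiSemiring) : Prop :=
  [/\ forall (A B : aiSemiring) (f : A -> B),
        is_hom f -> injective f -> K B -> K A,
      forall (A B : aiSemiring) (f : A -> B),
        is_hom f -> (forall b, exists a, f a = b) -> K A -> K B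
    & forall (I : Type) (A : I -> aiSemiring),
        (forall i, K (A i)) -> K (prod_ais A)].

Definition finitely_based (K : set aiSemiring) : Prop :=
  exists E : set identity, finite_set E /\ K = models E.

(* [smallest is_variety G] is the variety generated by [G]. *)
Definition finitely_generated (K : set aiSemiring) : Prop :=
  exists G : set aiSemiring,
    [/\ finite_set G,
        forall A : aiSemiring, G A -> finite_set [set: A]
      & K = smallest is_variety G].

Definition subvarieties (K : set aiSemiring) : set (set aiSemiring) :=
  [set W | is_variety W /\ W `<=` K].

Definition is_cross (K : set aiSemiring) : Prop :=
  [/\ is_variety K, finitely_based K, finitely_generated K
    & finite_set (subvarieties K)].

(* xy = xz *)
Definition xy_xz : identity := (Mul (Var 0) (Var 1), Mul (Var 0) (Var 2)).

Definition varR : set aiSemiring := models [set xy_xz].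

(* Main.v *)
(** In a member of [varR], xy = xx, so x |-> xx is an idempotent semilattice
    endomorphism.  For each element [a], x |-> ([x </= a], [xx </= a]) is a
    homomorphism to the four-element algebra [T] on {0,1}^2 with
    (p,q)(p',q') = (q,q), and these homomorphisms jointly separate points.  So
    every member of [varR] is a subdirect product of subalgebras of [T], and a
    subvariety is determined by the subalgebras of [T] that it contains; hence
    there are finitely many subvarieties, each finitely generated.  By
    Birkhoff's argument, needed only for countable algebras, each subalgebra of
    [T] outside a subvariety W violates an identity of W; one such identity for
    each, together with xy = xz, is a basis of W. *)
Require Import Defs.
From mathcomp Require Import all_boot.
From mathcomp Require Import boolp classical_sets functions cardinality.
Local Open Scope classical_set_scope.
Local Open Scope ais_scope.

(** * Equational classes are varieties *)

Lemma hom_eval (A B : aiSemiring) (f : A -> B) (v : nat -> A) (t : term) :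
  is_hom f -> f (eval v t) = eval (f \o v) t.
Proof. by case=> fD fM; elim: t => //= s <- t <-. Qed.

Lemma prod_eval (I : Type) (A : I -> aiSemiring) (v : nat -> prod_ais A)
    (t : term) (i : I) :
  eval v t i = eval (fun n => v n i) t.
Proof. by elim: t => //= s <- t <-. Qed.

Lemma models_variety (E : set identity) : is_variety (models E).
Proof.
split=> [A B f hf f_inj BE e Ee v|A B f hf f_surj AE e Ee v|I A AE e Ee v].
- by apply: f_inj; rewrite !hom_eval //; exact: BE.
- have [g gK] := choice f_surj.
  have -> : v = f \o (g \o v) by apply: funext => n /=; rewrite gK.
  by rewrite -!(hom_eval _ _ f) // (AE e Ee).
- by apply: functional_extensionality_dep => i; rewrite !prod_eval; exact: AE.
Qed.

(** * Subalgebras and Birkhoff's argument *)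

Definition subalgebra (A : aiSemiring) (P : set A) : Prop :=
  [/\ P !=set0, forall x y, P x -> P y -> P (x + y)
    & forall x y, P x -> P y -> P (x * y)].

Section Sub.
Variables (A : aiSemiring) (P : set A).
Hypothesis subP : subalgebra A P.

Definition sub_add (x y : {x | P x}) : {x | P x} :=
  let: And3 _ PD _ := subP in exist P _ (PD _ _ (svalP x) (svalP y)).
Definition sub_mul (x y : {x | P x}) : {x | P x} :=
  let: And3 _ _ PM := subP in exist P _ (PM _ _ (svalP x) (svalP y)).

Lemma sval_add : {morph sval : x y / sub_add x y >-> x + y}.
Proof. by rewrite /sub_add; case: subP. Qed.

Lemma sval_mul : {morph sval : x y / sub_mul x y >-> x * y}.
Proof. by rewrite /sub_mul; case: subP. Qed.

Lemma sval_inj : injective (@sval A P).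
Proof. by move=> [x Px] [y Py] /= xy; subst y; congr exist; exact: Prop_irrelevance. Qed.

Lemma sub_inhabited : inhabited {x | P x}.
Proof. by case: subP => -[x Px] _ _; exists; exists x. Qed.

Lemma sub_addA : associative sub_add.
Proof. by move=> x y z; apply: sval_inj; rewrite !sval_add ais_addA. Qed.

Lemma sub_addC : commutative sub_add.
Proof. by move=> x y; apply: sval_inj; rewrite !sval_add ais_addC. Qed.

Lemma sub_addI : idempotent_op sub_add.
Proof. by move=> x; apply: sval_inj; rewrite !sval_add ais_addI. Qed.

Lemma sub_mulA : associative sub_mul.
Proof. by move=> x y z; apply: sval_inj; rewrite !sval_mul ais_mulA. Qed.

Lemma sub_mulDr : right_distributive sub_mul sub_add.
Proof. by move=> x y z; apply: sval_inj; rewrite !(sval_mul, sval_add) ais_mulDr. Qed.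

Lemma sub_mulDl : left_distributive sub_mul sub_add.
Proof. by move=> x y z; apply: sval_inj; rewrite !(sval_mul, sval_add) ais_mulDl. Qed.

Definition sub_ais : aiSemiring :=
  AISemiring sub_inhabited sub_addA sub_addC sub_addI
    sub_mulA sub_mulDr sub_mulDl.

Lemma sval_hom : @is_hom sub_ais A sval.
Proof. by split; [exact: sval_add | exact: sval_mul]. Qed.

Lemma corestrict_hom (B : aiSemiring) (f : B -> A) (fP : forall b, P (f b)) :
  is_hom f -> @is_hom B sub_ais (fun b => exist P (f b) (fP b)).
Proof.
case=> fD fM; split=> x y; apply: sval_inj.
  by rewrite sval_add /= fD.
by rewrite sval_mul /= fM.
Qed.

End Sub.

Lemma sub_variety (W : set aiSemiring) (A : aiSemiring) (P : set A)
    (subP : subalgebra A P) :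
  is_variety W -> W A -> W (sub_ais A P subP).
Proof. by case=> WS _ _; apply: WS (sval_hom A P subP) (sval_inj A P). Qed.

Lemma eval_subalgebra (A : aiSemiring) (v : nat -> A) :
  subalgebra A (range (eval v)).
Proof.
split; first by exists (v 0%N); exists (Var 0).
  by move=> _ _ [s _ <-] [t _ <-]; exists (Add s t).
by move=> _ _ [s _ <-] [t _ <-]; exists (Mul s t).
Qed.

(* [A] is a quotient of the relatively free algebra of [W], realised as the
   subalgebra of term values in a product containing, for each identity that
   fails in [W], a member of [W] refuting it. *)
Lemma birkhoff_countable (W : set aiSemiring) (A : aiSemiring) :
  is_variety W -> countable [set: A] ->
  (forall e, (forall B, W B -> satisfies B e) -> satisfies A e) -> W A.
Proof.
move=> Wvar /countable_injP[g /in2TT g_inj] AW.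
have [a0] := ais_inhabited A.
(* Variables are named by the codes of elements, so that [v] is onto; [a0] fills the numbers that
   code nothing. *)
have [v vg] : exists v : nat -> A, forall a, v (g a) = a.
  have: forall n, exists a, forall b, g b = n -> a = b.
    move=> n; have [[b <-]|nb] := pselect (exists b, g b = n).
      by exists b => c /g_inj.
    by exists a0 => b gb; case: nb; exists b.
  by move=> /choice[v vP]; exists v => a; exact: vP.
have [W_S W_H W_P] := Wvar.
pose I := {e : identity | ~ forall B, W B -> satisfies B e}.
have: forall i : I, exists Bw : {B : aiSemiring & nat -> B},
    W (projT1 Bw) /\ eval (projT2 Bw) (sval i).1 <> eval (projT2 Bw) (sval i).2.
  case=> e /= /existsNP[B] /not_implyP[WB] /existsNP[w we].
  by exists (existT _ B w).
move=> /choice[Bw BwP].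
pose F := prod_ais (fun i => projT1 (Bw i)).
pose w n : F := fun i => projT2 (Bw i) n.
have WF : W F by apply: W_P => i; case: (BwP i).
(* If s = t failed in W, its own component of [F] would separate [eval w s] from [eval w t]; so s =
   t holds in W, hence in [A]. *)
have wv s t : eval w s = eval w t -> eval v s = eval v t.
  move=> st; apply: (AW (s, t)); apply: contrapT => nst.
  have [_ []] := BwP (exist _ (s, t) nst).
  have := congr1 (fun x : F => x (exist _ (s, t) nst)) st.
  by rewrite !prod_eval.
pose G := sub_ais F _ (eval_subalgebra F w).
have WG : W G by exact: sub_variety.
have: forall x : G, exists t, eval w t = sval x.
  by move=> [x xw]; have [t _ tx] := xw; exists t.
move=> /choice[r rP].
(* A term value under [w] goes to the value of the same term under [v]; by [wv] the term chosen by
   [r] does not matter. *)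
apply: (W_H G A (fun x => eval v (r x))) WG.
  split=> x y.
    apply: (wv _ (Add (r x) (r y))).
    by rewrite rP /= !rP; have [-> _] := sval_hom F _ (eval_subalgebra F w).
  apply: (wv _ (Mul (r x) (r y))).
  by rewrite rP /= !rP; have [_ ->] := sval_hom F _ (eval_subalgebra F w).
move=> a; have rg : range (eval w) (w (g a)) by exists (Var (g a)).
exists (exist _ _ rg); rewrite -[RHS]vg.
by apply: (wv _ (Var (g a))); rewrite rP.
Qed.

(** * The four-element algebra and its subalgebras *)

Definition T_add (p q : bool * bool) := (p.1 || q.1, p.2 || q.2).
Definition T_mul (p q : bool * bool) := (p.2, p.2).

Lemma T_addA : associative T_add.
Proof. by do 3![case=> [[] []]]. Qed.

Lemma T_addC : commutative T_add.
Proof. by do 2![case=> [[] []]]. Qed.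

Lemma T_addI : idempotent_op T_add.
Proof. by case=> [[] []]. Qed.

Lemma T_mulA : associative T_mul.
Proof. by []. Qed.

Lemma T_mulDr : right_distributive T_mul T_add.
Proof. by do 3![case=> [[] []]]. Qed.

Lemma T_mulDl : left_distributive T_mul T_add.
Proof. by do 3![case=> [[] []]]. Qed.

Definition T : aiSemiring :=
  AISemiring (inhabits (false, false)) T_addA T_addC T_addI
    T_mulA T_mulDr T_mulDl.

(* Junk value: [T] itself when [X] does not carry a subalgebra. *)
Definition subT (X : {set bool * bool}) : aiSemiring :=
  match pselect (subalgebra T [set` X]) with
  | left subX => sub_ais T _ subX
  | right _ => T
  end.

Lemma subT_finite (X : {set bool * bool}) : finite_set [set: subT X].
Proof.
rewrite /subT; case: pselect => [subX|_] /=; last exact: finite_finset.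
rewrite -(preimage_setT (@sval T _)); apply: finite_preimage; last exact: finite_finset.
by move=> x y _ _; exact: sval_inj.
Qed.

(** * Separation of points by homomorphisms to [T] *)

Section Separation.
Variable A : aiSemiring.
Hypothesis RA : varR A.

Lemma varR_mul (x y : A) : x * y = x * x.
Proof.
pose v n : A := if n is 1%N then y else x.
by have := RA xy_xz erefl v.
Qed.

(** Reading [x + a = a] as x <= a, sums are least upper bounds. *)
Lemma ais_add_le (a x y : A) : (x + y) + a = a <-> x + a = a /\ y + a = a.
Proof.
split=> [xya|[xa ya]]; last by rewrite -ais_addA ya.
split; rewrite -{1}xya; last by rewrite (ais_addC x y) !ais_addA ais_addI -(ais_addC x) xya.
by rewrite !ais_addA ais_addI.
Qed.

Definition toT (a x : A) : T := (~~ `[< x + a = a >], ~~ `[< x * x + a = a >]).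

(** Squaring respects sums, as (x + y)(x + y) = x(x + y) + y(x + y) = xx + yy, and (xy)(xy) = x(yxy)
    = xx gives both coordinates of a product the same value. *)
Lemma toT_hom (a : A) : is_hom (toT a).
Proof.
split=> x y; rewrite /toT /=.
  rewrite ais_mulDl (varR_mul x (x + y)) (varR_mul y (x + y)).
  by rewrite /T_add /= -!negb_and -!asbool_and !(asbool_equiv_eq (ais_add_le _ _ _)).
by rewrite /T_mul /= -ais_mulA !(varR_mul x).
Qed.

(** The first coordinates at a = x and a = y give y <= x and x <= y. *)
Lemma toT_inj (x y : A) : (forall a, toT a x = toT a y) -> x = y.
Proof.
move=> xy.
have le a : x + a = a <-> y + a = a.
  by apply: asbool_eq_equiv; apply: negb_inj; exact: (congr1 fst (xy a)).
by rewrite -(proj1 (le x) (ais_addI x)) ais_addC (proj2 (le y)) // ais_addI.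
Qed.

End Separation.

Lemma hom_image_subT (A : aiSemiring) (f : A -> T) : is_hom f ->
  exists X (g : A -> subT X) (i : subT X -> T),
    [/\ is_hom g, forall y, exists x, g x = y & forall x, i (g x) = f x].
Proof.
move=> f_hom; have [fD fM] := f_hom.
pose X := finset (fun p : bool * bool => `[< range f p >]).
have fX a : [set` X] (f a) by rewrite /= inE; apply/asboolP; exists a.
have Xf p : [set` X] p -> range f p by rewrite /= inE => /asboolP.
(* The image of a homomorphism is a subalgebra, so the junk case of [subT] is contradictory. *)
exists X; rewrite /subT; case: pselect => [subX|[]] /=; last first.
  have [a] := ais_inhabited A; split; first by exists (f a).
    by move=> _ _ /Xf[x _ <-] /Xf[y _ <-]; rewrite -fD; exact: fX.
  by move=> _ _ /Xf[x _ <-] /Xf[y _ <-]; rewrite -fM; exact: fX.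
exists (fun a => exist _ (f a) (fX a)), sval; split=> //.
  exact: corestrict_hom.
case=> p Xp; have [x _ fx] := Xf p Xp.
by exists x; apply: (sval_inj T).
Qed.

(** * Subvarieties compared through the algebras [subT X] *)

(** The image of [A] under each [toT A a] is in V as a quotient of [A], hence in W; [A] embeds in
    the product of these images over all its elements a. *)
Lemma subvariety_le (V W : set aiSemiring) :
  is_variety V -> is_variety W -> V `<=` varR ->
  (forall X, V (subT X) -> W (subT X)) -> V `<=` W.
Proof.
move=> [_ V_H _] [W_S _ W_P] VR VW A VA; have RA := VR A VA.
have: forall a, exists D : {X : {set bool * bool} & A -> subT X},
    [/\ is_hom (projT2 D), W (subT (projT1 D))
      & forall x y, projT2 D x = projT2 D y -> toT A a x = toT A a y].
  move=> a; have [X [g [i [g_hom g_surj ig]]]] := hom_image_subT A _ (toT_hom A RA a).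
  exists (existT _ X g); split=> //=; first exact: VW (V_H _ _ g _ _ _).
  by move=> x y gxy; rewrite -!ig gxy.
move=> /choice[D DP].
apply: (W_S A (prod_ais (fun a => subT (projT1 (D a))))
  (fun x a => projT2 (D a) x)).
- split=> x y; apply: functional_extensionality_dep => a;
    by case: (DP a) => -[gD gM] _ _; rewrite ?gD ?gM.
- move=> x y xy; apply: (toT_inj A) => a; case: (DP a) => _ _; apply.
  exact: (congr1 (fun h => h a) xy).
- by apply: W_P => a; case: (DP a).
Qed.

Lemma subvariety_generated (W : set aiSemiring) :
  is_variety W -> W `<=` varR ->
  W = smallest is_variety (subT @` [set X | W (subT X)]).
Proof.
move=> Wvar WR; apply/seteqP; split=> [A WA V [Vvar VG]|A]; last first.
  by apply; split=> // _ [X WX <-].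
by apply: subvariety_le WA => // X WX; apply: VG; exists X.
Qed.

Lemma subvariety_finitely_generated (W : set aiSemiring) :
  is_variety W -> W `<=` varR -> finitely_generated W.
Proof.
move=> Wvar WR; exists (subT @` [set X | W (subT X)]); split.
- exact/finite_image/finite_finset.
- by move=> _ [X _ <-]; exact: subT_finite.
- exact: subvariety_generated.
Qed.

Lemma finite_subvarieties : finite_set (subvarieties varR).
Proof.
pose gen (J : {set {set bool * bool}}) :=
  smallest is_variety (subT @` [set` J]).
apply: (@sub_finite_set _ _ (range gen)); last first.
  exact/finite_image/finite_finset.
(* W is recovered from the finite set of those X with [subT X] in W. *)
move=> W [Wvar WR]; exists (finset (fun X => `[< W (subT X) >])) => //.
rewrite [RHS]subvariety_generated // /gen; congr (smallest _ (_ @` _)).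
by apply/seteqP; split=> X; rewrite /= inE => /asboolP.
Qed.

Lemma subvariety_finitely_based (W : set aiSemiring) :
  is_variety W -> W `<=` varR -> finitely_based W.
Proof.
move=> Wvar WR.
have: forall X, exists e, (forall B, W B -> satisfies B e) /\
    (satisfies (subT X) e -> W (subT X)).
  move=> X; have [WX|nWX] := pselect (W (subT X)).
    (* Nothing has to be excluded here, so a trivial identity serves. *)
    by exists (Var 0, Var 0); split.
  have /existsNP[e /not_implyP[We nXe]] :
      ~ forall e, (forall B, W B -> satisfies B e) -> satisfies (subT X) e.
    move=> /(birkhoff_countable W _ Wvar (finite_set_countable (subT_finite X))).
    exact: nWX.
  by exists e.
move=> /choice[e eP].
exists (xy_xz |` range e); split.
  by rewrite finite_setU; split; [exact: finite_set1 | exact/finite_image/finite_finset].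
apply/seteqP; split=> [A WA _ [->|[X _ <-]]|].
- by apply: WR WA _ _.
- by case: (eP X) => + _; apply.
(* Conversely, a [subT X] satisfying the whole basis satisfies its own [e X], which forces it into
   W. *)
apply: subvariety_le => //; first exact: models_variety.
  by move=> A AE _ ->; apply: AE; left.
by move=> X XE; case: (eP X) => _; apply; apply: XE; right; exists X.
Qed.

Theorem corollary2p8 :
  is_cross varR /\
  (forall W : set aiSemiring, is_variety W -> W `<=` varR ->
     finitely_based W /\ finitely_generated W).
Proof.
have Rvar : is_variety varR by exact: models_variety.
split; last first.
  by move=> W Wvar WR; split;
    [exact: subvariety_finitely_based | exact: subvariety_finitely_generated].
split=> //; last exact: finite_subvarieties.
- exact: subvariety_finitely_based.
- exact: subvariety_finitely_generated.
Qed.
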